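(* Let $H$ be a Hilbert space, let $\{\mu_i\}_{i=1}^n$ be a normalized tight frame in a Hilbert subspace $L\subseteq H$ and let $\{f_i\}_{i=1}^n$ be a frame in a Hilbert subspace $K\subseteq H$, such that these two frames are weakly similar. Let $\{e_i\}_{i=1}^n$ be the standard orthonormal basis of $\mathbb{C}^n$, let $F:\mathbb{C}^n\to H$ be the linear operator with $F(e_i)=f_i$ for $i=1,\dots,n$, and let $F=W|F|$ be its polar decomposition. Put $N=\dim(\ker(|F|))$. Then $$\sum_{j=1}^n\|\mu_j-f_j\|^2\;\ge\;\sum_{j=1}^n\|W(e_j)-f_j\|^2\;=\;\|I-|F|\|_{c_2}^2-N .$$ Equality $\sum_{j=1}^n\|\mu_j-f_j\|^2=\sum_{j=1}^n\|W(e_j)-f_j\|^2$ holds if and only if $\mu_j=W(e_j)$ for every $j=1,2,\dots,n$. Consequently, the symmetric approximation of a frame $\{f_i\}_{i=1}^n$ in a finite-dimensional Hilbert space $K\subseteq H$ is a normalized tight frame spanning the same Hilbert subspace $L=K$ of $H$ and being similar to $\{f_i\}_{i=1}^n$.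
   Context: Hilbert spaces are complex; a Hilbert subspace is a closed linear subspace. A (finite or countable) family $\{f_i\}_i\subset K$ is a frame in a Hilbert subspace $K\subseteq H$ if there are constants $C,D>0$ with $C\|x\|^2\le\sum_j|\langle x,f_j\rangle|^2\le D\|x\|^2$ for all $x\in K$; it is normalized tight if one can take $C=D=1$. Two frames $\{f_i\}_i$ of $K$ and $\{g_i\}_i$ of $L$ (with the same index set) are weakly similar if there is an invertible bounded linear operator $T:K\to L$ with $T(f_i)=g_i$ for all $i$; if moreover $K=L$ they are called similar. The polar decomposition $F=W|F|$ has $|F|=(F^*F)^{1/2}$ on $\mathbb{C}^n$ and $W:\mathbb{C}^n\to H$ the partial isometry with initial space $\ker(F)^\perp$ and range $\operatorname{ran}(F)=K$. $I$ is the identity on $\mathbb{C}^n$, and $\|\cdot\|_{c_2}$ is the Hilbert-Schmidt norm. A normalized tight frame $\{\nu_i\}_{i=1}^n$ in a finite-dimensional Hilbert subspace $L\subseteq H$ is a symmetric approximation of the finite frame $\{f_i\}_{i=1}^n$ of $K\subseteq H$ if $\{f_i\}_{i=1}^n$ and $\{\nu_i\}_{i=1}^n$ are weakly similar and $\sum_{j=1}^n\|\mu_j-f_j\|^2\ge\sum_{j=1}^n\|\nu_j-f_j\|^2$ for all normalized tight frames $\{\mu_i\}_{i=1}^n$ in Hilbert subspaces of $H$ that are weakly similar to $\{f_i\}_{i=1}^n$. *)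

(* Defs.v *)
From HB Require Import structures.
From mathcomp Require Import all_boot all_order all_algebra complex.
From mathcomp Require Import boolp classical_sets functions reals.
From mathcomp Require Import topology normedtype.

Set Implicit Arguments.
Unset Strict Implicit.
Unset Printing Implicit Defensive.

Import Order.TTheory GRing.Theory Num.Theory Num.Def.
Import numFieldNormedType.Exports.
Local Open Scope classical_set_scope.
Local Open Scope ring_scope.

(* The scalars C are an arbitrary numClosedFieldType here; the complex numbers
   are C := R[i] with R : realType.  As in sesquilinear.v, inner products are
   linear in the first variable and conjugate-linear in the second.  Norms
   take their values in C, whose order is partial: x <= y means that y - x is
   a nonnegative real. *)

HB.mixin Record CompleteNormedModule_isHilbert (C : numClosedFieldType) H
    of CompleteNormedModule C H := {
  hdot : {dot H for @conjC C} ;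
  hnormE : forall x : H, `|x| ^+ 2 = hdot x x
}.

#[short(type="hilbertType")]
HB.structure Definition Hilbert (C : numClosedFieldType) :=
  {H of CompleteNormedModule C H & CompleteNormedModule_isHilbert C H}.

Section Frames.
Context {C : numClosedFieldType} {H : hilbertType C}.
Implicit Types (K L M : set H) (T S : H -> H).

Definition hilbert_subspace K : Prop :=
  [/\ K 0, forall (a : C) x y, K x -> K y -> K (a *: x + y) & closed K].

Definition linear_span n (f : 'I_n -> H) : set H :=
  [set x | exists c : 'I_n -> C, x = \sum_i c i *: f i].

Definition finite_dimensional K : Prop :=
  exists m (b : 'I_m -> H), K = linear_span b.

Definition frame_bounds n K (f : 'I_n -> H) (c d : C) : Prop :=
  forall x, K x ->
    c * `|x| ^+ 2 <= \sum_j `|hdot x (f j)| ^+ 2 <= d * `|x| ^+ 2.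

Definition frame n K (f : 'I_n -> H) : Prop :=
  (forall i, K (f i)) /\ exists c d, [/\ 0 < c, 0 < d & frame_bounds K f c d].

Definition normalized_tight_frame n K (f : 'I_n -> H) : Prop :=
  (forall i, K (f i)) /\ frame_bounds K f 1 1.

(* An operator K -> L is a function H -> H of which only the values on K
   matter. *)
Definition bounded_operator K L T : Prop :=
  [/\ forall x, K x -> L (T x),
      forall (a : C) x y, K x -> K y -> T (a *: x + y) = a *: T x + T y
    & exists b : C, forall x, K x -> `|T x| <= b * `|x|].

Definition invertible_operator K L T : Prop :=
  bounded_operator K L T /\
  exists S, [/\ bounded_operator L K S,
                forall x, K x -> S (T x) = x & forall y, L y -> T (S y) = y].

Definition weakly_similar_frames n K (f : 'I_n -> H) L (g : 'I_n -> H) :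
    Prop :=
  exists T, invertible_operator K L T /\ forall i, T (f i) = g i.

Definition similar_frames n K (f g : 'I_n -> H) : Prop :=
  weakly_similar_frames K f K g.

Definition sqdist n (g f : 'I_n -> H) : C := \sum_j `|g j - f j| ^+ 2.

Definition symmetric_approximation n K (f : 'I_n -> H) L (nu : 'I_n -> H) :
    Prop :=
  [/\ hilbert_subspace L, finite_dimensional L, normalized_tight_frame L nu,
      weakly_similar_frames K f L nu
    & forall M (mu : 'I_n -> H),
        hilbert_subspace M -> normalized_tight_frame M mu ->
        weakly_similar_frames M mu K f -> sqdist mu f >= sqdist nu f].

End Frames.

(* C^n is 'rV[C]_n with the inner product dotmx of spectral.v; its standard
   basis is 'e_i. *)
Section PolarDecomposition.
Context {C : numClosedFieldType} {H : hilbertType C} {n : nat}.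
Implicit Types (F W : {linear 'rV[C]_n -> H}) (A : 'End('rV[C]_n)).

Definition adjoint F (y : H) : 'rV[C]_n := \row_i hdot y (F 'e_i).

Lemma adjointP F (x : 'rV[C]_n) (y : H) :
  hdot (F x) y = dotmx x (adjoint F y).
Proof.
rewrite {1}(row_sum_delta x) linear_sum linear_sumlz dotmxE mxE.
apply: eq_bigr => i _; rewrite linearZ linearZl_LR /= !mxE; congr (_ * _).
by rewrite [LHS](hermC hdot) expr0 mul1r.
Qed.

(* Over the complex numbers, 0 <= <A x, x> for all x forces A to be
   self-adjoint. *)
Definition positive_operator A : Prop := forall x, 0 <= dotmx (A x) x.

(* A = (F^* F)^(1/2) *)
Definition absolute_value F A : Prop :=
  positive_operator A /\ forall x, A (A x) = adjoint F (F x).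

Definition kernel F : set 'rV[C]_n := [set x | F x = 0].

Definition orthogonal_complement (V : set 'rV[C]_n) : set 'rV[C]_n :=
  [set x | forall y, V y -> dotmx x y = 0].

Definition partial_isometry W (V : set 'rV[C]_n) (U : set H) : Prop :=
  [/\ forall x, V x -> `|W x| ^+ 2 = dotmx x x,
      forall x, orthogonal_complement V x -> W x = 0
    & range W = U].

Definition polar_decomposition F W A : Prop :=
  [/\ absolute_value F A,
      partial_isometry W (orthogonal_complement (kernel F)) (range F)
    & forall x, F x = W (A x)].

Definition hs_norm A : C := sqrtC (\sum_j dotmx (A 'e_j) (A 'e_j)).

End PolarDecomposition.

(* Main.v *)
(* Let u_k be an orthonormal eigenbasis of |F| in C^n, |F| u_k = s_k u_k, and
   w_k = W u_k, so that F u_k = s_k w_k, where w_k is a unit vector if s_k <> 0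
   and w_k = 0 otherwise.  If M e_j = mu_j, tightness says that M is a partial
   isometry and weak similarity says that ker M = ker F; hence M u_k is also a
   unit vector if s_k <> 0 and 0 otherwise.  The sums of squares do not depend
   on the orthonormal basis, and comparing them term by term in u_k gives
     sum |mu_j - f_j|^2 - sum |W e_j - f_j|^2 = sum s_k |M u_k - w_k|^2. *)
Require Import Defs.
From HB Require Import structures.
From mathcomp Require Import all_boot all_order all_algebra complex.
From mathcomp Require Import boolp classical_sets functions reals.
From mathcomp Require Import topology normedtype.
From mathcomp Require Import ring.

Set Implicit Arguments.
Unset Strict Implicit.
Unset Printing Implicit Defensive.

Import Order.TTheory GRing.Theory Num.Theory Num.Def.
Import numFieldNormedType.Exports.
Local Open Scope classical_set_scope.
Local Open Scope ring_scope.

(** * Inner products, orthonormal bases and positive operators on C^n *)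

Section DotProduct.
Local Open Scope sesquilinear_scope.
Context {C : numClosedFieldType}.

Lemma dot_conj (V : lmodType C) (dot : {dot V for @conjC C}) x y :
  (dot x y)^* = dot y x.
Proof. by rewrite [RHS](hermC dot) expr0 mul1r. Qed.

(** For y nonzero, the squared norm of <y,y> x - <x,y> y is <y,y> times the difference of the two
    sides. *)
Lemma dot_cauchy_schwarz (V : lmodType C)
    (dot : {dot V for @conjC C}) x y :
  `|dot x y| ^+ 2 <= dot x x * dot y y.
Proof.
have [->|y0] := eqVneq y 0; first by rewrite !linear0r normr0 expr0n mulr0.
have yy : 0 < dot y y by rewrite dnorm_gt0.
rewrite -subr_ge0 -(pmulr_rge0 _ yy).
have := dnorm_ge0 dot (dot y y *: x - dot x y *: y).
rewrite !linearBl /= !linearBr /= !linearZl_LR /= !linearZr_LR /=.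
rewrite !dot_conj normCK dot_conj.
by congr (0 <= _); ring.
Qed.

Lemma dot_delta n (x : 'rV[C]_n) j : dotmx x 'e_j = x 0 j.
Proof.
rewrite dotmxE mxE (bigD1 j) //= big1 => [|i /negPf ij].
  by rewrite !mxE !eqxx conjC1 mulr1 addr0.
by rewrite !mxE eqxx ij conjC0 mulr0.
Qed.

Section UnitaryRows.
Context {n : nat} {U : 'M[C]_n} (unitaryU : U \is unitarymx).

Lemma unitary_expansion (x : 'rV[C]_n) :
  x = \sum_k dotmx x (row k U) *: row k U.
Proof.
rewrite -{1}(mulmxKtV x unitaryU erefl) mulmx_sum_row.
apply: eq_bigr => k _; congr (_ *: _).
by rewrite dotmxE !mxE; apply: eq_bigr => j _; rewrite !mxE.
Qed.

Lemma linear_unitary_expansion (V : lmodType C) (G : {linear 'rV[C]_n -> V}) x :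
  G x = \sum_k dotmx x (row k U) *: G (row k U).
Proof.
rewrite {1}(unitary_expansion x) linear_sum.
by apply: eq_bigr => k _; rewrite linearZ.
Qed.

Lemma unitary_dot k l : dotmx (row k U) (row l U) = (k == l)%:R.
Proof. exact: row_unitarymxP. Qed.

Lemma unitary_row_inj : injective (fun k => row k U).
Proof.
move=> k l /= kl; have := unitary_dot k l; rewrite kl unitary_dot eqxx.
by case: eqP => // _ /eqP; rewrite oner_eq0.
Qed.

(** Basis independence of the Hilbert-Schmidt norm: expand each ['e_j] in the rows of [U] and sum
    over [j] first; orthonormality of the rows then leaves only the terms with [l = k]. *)
Lemma sum_dot_unitary (V : lmodType C) (dot : {dot V for @conjC C})
    (G : {linear 'rV[C]_n -> V}) :
  \sum_j dot (G 'e_j) (G 'e_j) = \sum_k dot (G (row k U)) (G (row k U)).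
Proof.
transitivity (\sum_j \sum_k \sum_l
    (U l j * (U k j)^*) * dot (G (row k U)) (G (row l U))).
  apply: eq_bigr => j _.
  have Ge : G 'e_j = \sum_k (U k j)^* *: G (row k U).
    rewrite (linear_unitary_expansion G 'e_j); apply: eq_bigr => k _.
    by rewrite -dot_conj /= dot_delta mxE.
  rewrite {1}Ge linear_sumlz; apply: eq_bigr => k _.
  rewrite linearZl_LR /= Ge linear_sumr mulr_sumr; apply: eq_bigr => l _.
  by rewrite linearZr_LR /= conjCK mulrA [(_)^* * _]mulrC.
rewrite exchange_big; apply: eq_bigr => k _; rewrite exchange_big /=.
have UU l : \sum_j U l j * (U k j)^* = (l == k)%:R.
  by rewrite -unitary_dot dotmxE mxE; apply: eq_bigr => j _; rewrite !mxE.
rewrite (bigD1 k) //= [X in _ + X]big1 => [|l /negPf lk].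
  by rewrite addr0 -mulr_suml UU eqxx mul1r.
by rewrite -mulr_suml UU lk mul0r.
Qed.

End UnitaryRows.

(** Polarization: <A z, z> is real at z = x + y and at z = x + iy, which gives two relations between
    <A x, y>, <A y, x> and their conjugates. *)
Lemma positive_operator_symmetric n (A : 'End('rV[C]_n)) x y :
  positive_operator A -> dotmx (A x) y = dotmx x (A y).
Proof.
move=> posA.
have realA z : (dotmx (A z) z)^* = dotmx (A z) z.
  by apply/CrealP/ger0_real/posA.
rewrite -[RHS]dot_conj.
have eD := realA (x + y).
have eI := realA (x + 'i *: y).
move: eD eI; rewrite !linearD /= !linearZ /= !linearDl /= !linearDr /=.
rewrite !linearZl_LR /= !linearZr_LR /= !rmorphD /= !rmorphM /= !realA.
rewrite conjCK !conjCi.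
set a := dotmx (A x) y; set b := dotmx (A y) x => eD eI.
move: eD eI.
set p := dotmx _ x; set q := dotmx _ y; set a' := _^*; set b' := _^*.
move=> eD eI.
have {}eD : a' + b' - (a + b) = 0.
  by move/eqP: eD; rewrite -subr_eq0 => /eqP <-; ring.
have {}eI : 'i * (a' - b') - 'i * (b - a) = 0.
  by move/eqP: eI; rewrite -subr_eq0 => /eqP <-; ring.
(* This is i times the relation from x + y minus the relation from x + iy. *)
have /eqP : (2 * 'i) * (b' - a) = 0.
  by rewrite -[RHS](subrr 0) -[X in _ = _ - X]eI -[X in _ = X - _](mulr0 'i) -eD;
    ring.
by rewrite !mulf_eq0 pnatr_eq0 (negPf (neq0Ci C)) /= subr_eq0 => /eqP.
Qed.

(** The spectral theorem for the matrix [B], hermitian by symmetry of [A]. Vectors are rows and [B]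
    acts from the right, so the eigenvectors are the rows of [spectralmx B]; each eigenvalue equals
    <A u, u> for its unit eigenvector u, hence is nonnegative. *)
Lemma positive_operator_eigenbasis n (A : 'End('rV[C]_n)) :
  positive_operator A ->
  exists (U : 'M[C]_n) (s : 'I_n -> C),
    [/\ U \is unitarymx, forall k, 0 <= s k
      & forall k, A (row k U) = s k *: row k U].
Proof.
move=> posA; pose B := lin1_mx A.
have hermB : B \is hermsymmx.
  apply/is_hermitianmxP; rewrite expr0 scale1r; apply/matrixP => i j.
  have := positive_operator_symmetric 'e_i 'e_j posA.
  by rewrite -[RHS]dot_conj /= !dot_delta !mxE.
have eigA k :
    A (row k (spectralmx B)) = spectral_diag B 0 k *: row k (spectralmx B).
  have /orthomx_spectralP BE := hermitian_normalmx hermB.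
  rewrite -(mul_rV_lin1 A) -/B -row_mul [X in _ *m X]BE.
  by rewrite !mulmxA mulmxV ?spectral_unit // mul1mx row_mul row_diag_mx
    -scalemxAl -rowE.
exists (spectralmx B), (spectral_diag B 0).
split=> [|k|//]; first exact: spectral_unitarymx.
have := posA (row k (spectralmx B)).
by rewrite eigA linearZl_LR /= unitary_dot ?spectral_unitarymx // eqxx mulr1.
Qed.

(** If A x = 0, then 0 = <A x, u_k> = s_k <x, u_k>, so x only involves eigenvectors with s_k = 0;
    these are orthonormal, hence a basis of the kernel. *)
Lemma dim_lker_diagonal n (A : 'End('rV[C]_n)) (U : 'M[C]_n) (s : 'I_n -> C) :
  U \is unitarymx -> (forall k, A (row k U) = s k *: row k U) ->
  \dim (lker A) = #|[pred k | s k == 0]|.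
Proof.
move=> unitaryU eigA.
pose X := [seq row k U | k <- enum [pred k | s k == 0]].
have orthoX : orthonormal (@dotmx C n) X.
  apply/orthonormalP; split=> [|_ _ /mapP[k _ ->] /mapP[l _ ->]].
    by rewrite map_inj_uniq ?enum_uniq //; exact: unitary_row_inj.
  by rewrite /= unitary_dot // (inj_eq (unitary_row_inj unitaryU)).
have -> : lker A = <<X>>%VS.
  apply/eqP; rewrite eqEsubv; apply/andP; split; last first.
    apply/span_subvP => _ /mapP [k + ->].
    by rewrite mem_enum inE memv_ker eigA => /eqP ->; rewrite scale0r.
  apply/subvP => x; rewrite memv_ker => /eqP Ax0.
  rewrite (unitary_expansion unitaryU x); apply: memv_suml => k _.
  have [sk|sk] := eqVneq (s k) 0.
    by apply/memvZ/memv_span/map_f; rewrite mem_enum inE sk.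
  suff -> : dotmx x (row k U) = 0 by rewrite scale0r mem0v.
  have : dotmx (A x) (row k U) = 0 by rewrite Ax0 linear0l.
  rewrite (linear_unitary_expansion unitaryU A) linear_sumlz (bigD1 k) //= big1.
    rewrite addr0 linearZl_LR /= eigA linearZl_LR /= unitary_dot // eqxx mulr1.
    by move/eqP; rewrite mulf_eq0 (negPf sk) orbF => /eqP.
  move=> l /negPf lk; rewrite linearZl_LR /= eigA linearZl_LR /= unitary_dot //.
  by rewrite lk !mulr0.
have /eqP -> : free X by apply: orthonormal_free orthoX.
by rewrite size_map cardE.
Qed.

End DotProduct.

(** * Hilbert subspaces, weak similarity and tight frames, seen through operators on C^n *)

Section Subspaces.
Context {C : numClosedFieldType} {H : hilbertType C}.
Implicit Types (K L : set H).

Lemma hilbert_subspaceD K x y : hilbert_subspace K -> K x -> K y -> K (x + y).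
Proof. by case=> _ linK _ Kx Ky; have := linK 1 _ _ Kx Ky; rewrite scale1r. Qed.

Lemma hilbert_subspaceZ K a x : hilbert_subspace K -> K x -> K (a *: x).
Proof. by case=> K0 linK _ Kx; have := linK a _ _ Kx K0; rewrite addr0. Qed.

Lemma hilbert_subspaceB K x y : hilbert_subspace K -> K x -> K y -> K (x - y).
Proof.
by move=> hK Kx Ky; rewrite -scaleN1r; apply: hilbert_subspaceD => //;
  apply: hilbert_subspaceZ.
Qed.

Lemma hilbert_subspace_sum K n (c : 'I_n -> C) (b : 'I_n -> H) :
  hilbert_subspace K -> (forall i, K (b i)) -> K (\sum_i c i *: b i).
Proof.
move=> hK Kb; apply: (big_ind K) => [|x y|i _]; first by case: hK.
  exact: hilbert_subspaceD.
exact: hilbert_subspaceZ.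
Qed.

Lemma linear_extension n (f : 'I_n -> H) :
  exists F : {linear 'rV[C]_n -> H}, forall i, F 'e_i = f i.
Proof.
pose F (x : 'rV[C]_n) := \sum_i x 0 i *: f i.
have linF : linear F.
  move=> a x y; rewrite /F scaler_sumr -big_split; apply: eq_bigr => i _ /=.
  by rewrite !mxE scalerDl scalerA.
pose mixF := GRing.isLinear.Build _ _ _ _ F linF.
pose G : {linear 'rV[C]_n -> H} := HB.pack F mixF.
exists G => i; rewrite /G /= /F (bigD1 i) //= big1 => [|j /negPf ji].
  by rewrite addr0 mxE !eqxx scale1r.
by rewrite mxE ji andbF scale0r.
Qed.

Lemma linear_delta_expansion n (F : {linear 'rV[C]_n -> H}) x :
  F x = \sum_i x 0 i *: F 'e_i.
Proof.
rewrite {1}(row_sum_delta x) linear_sum.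
by apply: eq_bigr => i _; rewrite linearZ.
Qed.

Lemma linear_span_range n (F : {linear 'rV[C]_n -> H}) :
  linear_span (fun i => F 'e_i) = range F.
Proof.
rewrite predeqE => y; split=> [[c ->]|[x _ <-]].
  exists (\row_i c i) => //; rewrite linear_delta_expansion.
  by apply: eq_bigr => i _; rewrite mxE.
by exists (fun i => x 0 i); exact: linear_delta_expansion.
Qed.

Lemma hilbert_subspace_range K n (F : {linear 'rV[C]_n -> H}) x :
  hilbert_subspace K -> (forall i, K (F 'e_i)) -> K (F x).
Proof.
by move=> hK KF; rewrite linear_delta_expansion; exact: hilbert_subspace_sum.
Qed.

(** [T] is linear only on [K], so the induction over the sum must carry membership in [K] along with
    the value of [T]. *)
Lemma bounded_operator_linear_comp K L T n (F G : {linear 'rV[C]_n -> H}) x :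
  hilbert_subspace K -> bounded_operator K L T -> (forall i, K (F 'e_i)) ->
  (forall i, T (F 'e_i) = G 'e_i) -> T (F x) = G x.
Proof.
move=> hK [_ linT _] KF TF; rewrite !linear_delta_expansion.
have [K0 _ _] := hK.
have T0 : T 0 = 0.
  by have := linT (-1) 0 0 K0 K0; rewrite scaler0 addr0 scaleN1r addNr.
suff [] : K (\sum_i x 0 i *: F 'e_i) /\
    T (\sum_i x 0 i *: F 'e_i) = \sum_i x 0 i *: G 'e_i by [].
apply: (big_ind2 (fun u v => K u /\ T u = v)).
- by [].
- move=> u1 u2 v1 v2 [K1 <-] [K2 <-].
  split; first exact: hilbert_subspaceD.
  by have := linT 1 _ _ K1 K2; rewrite !scale1r.
- move=> i _; split; first exact: hilbert_subspaceZ.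
  by have := linT (x 0 i) _ _ (KF i) K0; rewrite !addr0 T0 addr0 TF.
Qed.

Lemma weakly_similar_frames_sym K L n (f g : 'I_n -> H) :
  (forall i, K (f i)) -> weakly_similar_frames K f L g ->
  weakly_similar_frames L g K f.
Proof.
move=> Kf [T [[bT [S [bS ST TS]]] Tf]]; exists S; split.
  by split=> //; exists T.
by move=> i; rewrite -Tf ST.
Qed.

(** The similarity operator sends F x to G x for all x, and sends 0 = F 0 to G 0 = 0. *)
Lemma weakly_similar_frames_kernel K L n (F G : {linear 'rV[C]_n -> H}) x :
  hilbert_subspace K -> hilbert_subspace L ->
  (forall i, K (F 'e_i)) -> (forall i, L (G 'e_i)) ->
  weakly_similar_frames K (fun i => F 'e_i) L (fun i => G 'e_i) ->
  F x = 0 -> G x = 0.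
Proof.
move=> hK hL KF LG [T [[bT _] TF]] Fx0.
rewrite -(bounded_operator_linear_comp x hK bT KF TF) Fx0.
have := bounded_operator_linear_comp 0 hK bT KF TF.
by rewrite !linear0.
Qed.

(** The coordinate of [adjoint W y] along u_k is <y, W u_k>, so the frame operator may be computed
    in any orthonormal basis. *)
Lemma frame_operator_expansion n (U : 'M[C]_n) (W : {linear 'rV[C]_n -> H}) y :
  U \is unitarymx ->
  W (adjoint W y) = \sum_k hdot y (W (row k U)) *: W (row k U).
Proof.
move=> unitaryU; rewrite (linear_unitary_expansion unitaryU W).
apply: eq_bigr => k _; congr (_ *: _).
by rewrite -[LHS]dot_conj -[RHS]dot_conj /= adjointP.
Qed.

Lemma dot_adjoint n (F : {linear 'rV[C]_n -> H}) y :
  dotmx (adjoint F y) (adjoint F y) = \sum_j `|hdot y (F 'e_j)| ^+ 2.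
Proof.
by rewrite dotmxE mxE; apply: eq_bigr => j _; rewrite !mxE normCK.
Qed.

(** Tightness says that the self-adjoint D = M M^* - 1 satisfies <D y, y> = 0 on [L]. Taking y = x +
    D x, only the two cross terms remain, each equal to |D x|^2, so D x = 0. *)
Lemma normalized_tight_frame_reconstruction L n (M : {linear 'rV[C]_n -> H}) x :
  hilbert_subspace L -> normalized_tight_frame L (fun i => M 'e_i) -> L x ->
  M (adjoint M x) = x.
Proof.
move=> hL [LM tightM] Lx.
pose D y := M (adjoint M y) - y.
have LD y : L y -> L (D y).
  by move=> Ly; apply: hilbert_subspaceB => //; exact: hilbert_subspace_range.
have D0 y : L y -> hdot (D y) y = 0.
  move=> /tightM; rewrite mul1r -eq_le linearBl /= adjointP dot_adjoint -hnormE.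
  by move=> /eqP ->; rewrite subrr.
have symD y z : hdot (D y) z = hdot y (D z).
  rewrite linearBl linearBr /= -[in RHS]dot_conj /= !adjointP; congr (_ - _).
  by rewrite dot_conj.
have DD y z : D (y + z) = D y + D z.
  have adjD : adjoint M (y + z) = adjoint M y + adjoint M z.
    by apply/rowP => j; rewrite !mxE linearDl.
  by rewrite /D adjD linearD opprD addrACA.
have LDx := LD _ Lx.
have := D0 _ (hilbert_subspaceD hL Lx LDx).
rewrite DD linearDl /= [hdot (D x) _]linearDr [hdot (D (D x)) _]linearDr /=.
rewrite !D0 // add0r addr0 [hdot (D (D x)) x]symD.
rewrite -mulr2n => /eqP; rewrite mulrn_eq0 /= dnorm_eq0 subr_eq0.
by move/eqP.
Qed.

(** By reconstruction M^* M x - x lies in ker M, hence is orthogonal to x: thus <M^* M x, x> = <x,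
    x>. *)
Lemma normalized_tight_frame_isometry L n (M : {linear 'rV[C]_n -> H}) x :
  hilbert_subspace L -> normalized_tight_frame L (fun i => M 'e_i) ->
  (forall y, M y = 0 -> dotmx y x = 0) -> hdot (M x) (M x) = dotmx x x.
Proof.
move=> hL tightM xker; have [LM _] := tightM.
have : M (adjoint M (M x) - x) = 0.
  rewrite linearB /=.
  rewrite (normalized_tight_frame_reconstruction hL tightM) ?subrr //.
  exact: hilbert_subspace_range.
move/xker/eqP; rewrite linearBl subr_eq0 /= => /eqP <-.
by rewrite adjointP -[RHS]dot_conj /= -adjointP dot_conj.
Qed.

Lemma normalized_tight_frame_span L n (M : {linear 'rV[C]_n -> H}) :
  hilbert_subspace L -> normalized_tight_frame L (fun i => M 'e_i) ->
  linear_span (fun i => M 'e_i) = L.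
Proof.
move=> hL tightM; rewrite linear_span_range predeqE => y; split=> [[x _ <-]|Ly].
  by have [LM _] := tightM; exact: hilbert_subspace_range.
exists (adjoint M y) => //; exact: (normalized_tight_frame_reconstruction hL).
Qed.

End Subspaces.

(** * Singular systems and the comparison of distances *)

Section SingularSystem.
Context {C : numClosedFieldType} {H : hilbertType C} {n : nat}.
Implicit Types (F W M : {linear 'rV[C]_n -> H}) (A : 'End('rV[C]_n)).

(** A singular value decomposition: the rows of [U] are the right singular vectors, and [W] maps
    them to the left ones, or to 0 where the singular value vanishes. It serves both for a given
    polar decomposition and for a constructed [W]. *)
Definition singular_system F W (U : 'M[C]_n) (s : 'I_n -> C) : Prop :=
  [/\ U \is unitarymx, forall k, 0 <= s k,
      forall k, F (row k U) = s k *: W (row k U)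
    & forall k l, hdot (W (row k U)) (W (row l U)) =
        ((k == l) && (s k != 0))%:R].

Lemma sqdist_unitary (U : 'M[C]_n) F M : U \is unitarymx ->
  sqdist (fun j => M 'e_j) (fun j => F 'e_j) =
    \sum_k hdot (M (row k U) - F (row k U)) (M (row k U) - F (row k U)).
Proof.
move=> unitaryU; rewrite -(sum_dot_unitary unitaryU hdot (M \- F)).
by apply: eq_bigr => j _; rewrite hnormE.
Qed.

Section System.
Variables (F W : {linear 'rV[C]_n -> H}) (U : 'M[C]_n) (s : 'I_n -> C).
Hypothesis sysF : singular_system F W U s.

Lemma singular_system_zero k : s k = 0 -> W (row k U) = 0.
Proof.
case: sysF => _ _ _ dotW sk; apply/eqP; rewrite -(dnorm_eq0 hdot) dotW.
by rewrite sk !eqxx.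
Qed.

Lemma singular_system_ker k : s k = 0 -> F (row k U) = 0.
Proof. by case: sysF => _ _ -> _ ->; rewrite scale0r. Qed.

(** Pairing F x with W u_k leaves only s_k <x, u_k>. *)
Lemma singular_system_orthogonal k x :
  s k != 0 -> F x = 0 -> dotmx x (row k U) = 0.
Proof.
case: sysF => unitaryU _ FW dotW sk Fx.
have : hdot (F x) (W (row k U)) = 0 by rewrite Fx linear0l.
rewrite (linear_unitary_expansion unitaryU F) linear_sumlz (bigD1 k) //= big1.
  rewrite addr0 linearZl_LR /= FW linearZl_LR /= dotW eqxx sk mulr1.
  by move/eqP; rewrite mulf_eq0 (negPf sk) orbF => /eqP.
move=> l /negPf lk; rewrite linearZl_LR /= FW linearZl_LR /= dotW lk.
by rewrite !mulr0.
Qed.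

(* For unit vectors m and w and s >= 0,
   |m - s w|^2 = |w - s w|^2 + s |m - w|^2. *)
Lemma sqdist_singular_system M :
  (forall k, hdot (M (row k U)) (M (row k U)) = (s k != 0)%:R) ->
  sqdist (fun j => M 'e_j) (fun j => F 'e_j) =
    sqdist (fun j => W 'e_j) (fun j => F 'e_j) +
    \sum_k s k * `|M (row k U) - W (row k U)| ^+ 2.
Proof.
case: sysF => unitaryU s_ge0 FW dotW dotM.
rewrite !(sqdist_unitary _ _ unitaryU) -big_split; apply: eq_bigr => k _ /=.
rewrite hnormE FW; have := dotM k; have := dotW k k; rewrite eqxx /=.
have sC : (s k)^* = s k by apply/CrealP/ger0_real.
set m := M _; set w := W _ => ww mm.
rewrite !linearBl /= !linearBr /= !linearZl_LR /= !linearZr_LR /= sC ww mm.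
have [sk|_] := eqVneq (s k) 0; first by rewrite sk; ring.
ring.
Qed.

Lemma le_sqdist_singular_system M :
  (forall k, hdot (M (row k U)) (M (row k U)) = (s k != 0)%:R) ->
  sqdist (fun j => W 'e_j) (fun j => F 'e_j) <=
    sqdist (fun j => M 'e_j) (fun j => F 'e_j).
Proof.
move=> dotM; rewrite (sqdist_singular_system dotM) lerDl sumr_ge0 // => k _.
by case: sysF => _ s_ge0 _ _; rewrite mulr_ge0 ?exprn_ge0.
Qed.

(** Equality forces each nonnegative term s_k |M u_k - W u_k|^2 to vanish; where s_k = 0, both M u_k
    and W u_k are 0 already. So [M] and [W] agree on a basis. *)
Lemma eq_sqdist_singular_system M x :
  (forall k, hdot (M (row k U)) (M (row k U)) = (s k != 0)%:R) ->
  sqdist (fun j => M 'e_j) (fun j => F 'e_j) =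
    sqdist (fun j => W 'e_j) (fun j => F 'e_j) -> M x = W x.
Proof.
case: sysF => unitaryU s_ge0 _ _ dotM.
rewrite (sqdist_singular_system dotM) -[RHS]addr0 => /addrI/eqP.
rewrite psumr_eq0 => [/allP excess0|k _]; last by rewrite mulr_ge0 ?exprn_ge0.
rewrite (linear_unitary_expansion unitaryU M).
rewrite (linear_unitary_expansion unitaryU W).
apply: eq_bigr => k _; congr (_ *: _).
have [sk|sk] := eqVneq (s k) 0.
  rewrite (singular_system_zero sk); apply/eqP.
  by rewrite -(dnorm_eq0 hdot) dotM sk eqxx.
have := excess0 k (mem_index_enum k).
by rewrite mulf_eq0 (negPf sk) expf_eq0 normr_eq0 subr_eq0 => /eqP.
Qed.

End System.

Lemma polar_decomposition_singular_system F W A : polar_decomposition F W A ->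
  exists (U : 'M[C]_n) (s : 'I_n -> C),
    singular_system F W U s /\ forall k, A (row k U) = s k *: row k U.
Proof.
move=> [[posA AA] [_ W0 _] FW].
have [U [s [unitaryU s_ge0 eigA]]] := positive_operator_eigenbasis posA.
have FWs k : F (row k U) = s k *: W (row k U) by rewrite FW eigA linearZ.
(* Such an eigenvector lies in ker F, hence is orthogonal to the initial space of [W]. *)
have W0s k : s k = 0 -> W (row k U) = 0.
  move=> sk; apply: W0 => y kery; rewrite -dot_conj; apply/eqP.
  rewrite conjC_eq0; apply/eqP/kery => /=; rewrite /kernel /=.
  by rewrite FWs sk scale0r.
exists U, s; split=> //; split=> // k l.
have [sk|sk] := eqVneq (s k) 0; first by rewrite W0s // linear0l andbF.
have [sl|sl] := eqVneq (s l) 0.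
  rewrite [in LHS](W0s l) // linear0r; case: eqP => // kl.
  by rewrite kl sl eqxx in sk.
(* Comes from F^* F = A^2; it is written with the factors s_k s_l so that they cancel against F u =
   s W u on the left. *)
have : hdot (F (row k U)) (F (row l U)) = s k * (s l * (k == l)%:R).
  rewrite adjointP -AA eigA linearZ /= eigA scalerA linearZr_LR /=.
  rewrite unitary_dot // rmorphM /= !(CrealP (ger0_real (s_ge0 _))).
  by case: eqP => [->|]; rewrite ?mulr1 ?mulr0.
rewrite !FWs linearZl_LR /= linearZr_LR /= (CrealP (ger0_real (s_ge0 _))).
by move/(mulfI sk)/(mulfI sl) ->; rewrite andbT.
Qed.

(** In the eigenbasis both sides have the term (1 - s_k)^2 where s_k is nonzero; where s_k = 0 the
    left term is 0 and the Hilbert-Schmidt term is 1, which the kernel dimension removes. *)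
Lemma sqdist_hs_norm F W A U s : singular_system F W U s ->
  (forall k, A (row k U) = s k *: row k U) ->
  sqdist (fun j => W 'e_j) (fun j => F 'e_j) =
    hs_norm (\1%VF - A) ^+ 2 - (\dim (lker A))%:R.
Proof.
move=> sysF eigA; have [unitaryU s_ge0 FW dotW] := sysF.
rewrite (sqdist_unitary _ _ unitaryU) sqrtCK.
rewrite (sum_dot_unitary unitaryU (@dotmx C n)).
rewrite (dim_lker_diagonal unitaryU eigA) -sum1_card natr_sum.
rewrite [X in _ - X]big_mkcond -sumrB; apply: eq_bigr => k _.
rewrite FW /= add_lfunE opp_lfunE id_lfunE eigA.
rewrite !linearBl /= !linearBr /= !linearZl_LR /= !linearZr_LR /= inE.
rewrite unitary_dot // dotW (CrealP (ger0_real (s_ge0 _))) eqxx /=.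
by have [->|_] := eqVneq (s k) 0; rewrite /=; ring.
Qed.

(** Weak similarity gives ker M = ker F. Hence M u_k = 0 where s_k = 0, and the other u_k are
    orthogonal to ker M, where [M] is isometric. *)
Lemma tight_frame_singular_norm L K M F W U s :
  hilbert_subspace L -> hilbert_subspace K ->
  normalized_tight_frame L (fun j => M 'e_j) -> (forall j, K (F 'e_j)) ->
  weakly_similar_frames L (fun j => M 'e_j) K (fun j => F 'e_j) ->
  singular_system F W U s ->
  forall k, hdot (M (row k U)) (M (row k U)) = (s k != 0)%:R.
Proof.
move=> hL hK tightM KF simM sysF k; have [LM _] := tightM.
have [unitaryU _ _ _] := sysF.
have FM x : F x = 0 -> M x = 0.
  apply: (weakly_similar_frames_kernel hK hL KF LM).
  exact: weakly_similar_frames_sym.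
have MF x : M x = 0 -> F x = 0.
  exact: (weakly_similar_frames_kernel hL hK LM KF).
have [sk|sk] := eqVneq (s k) 0.
  by rewrite FM ?linear0l // (singular_system_ker sysF).
rewrite (normalized_tight_frame_isometry hL tightM) ?unitary_dot ?eqxx //.
by move=> y /MF; exact: (singular_system_orthogonal sysF).
Qed.

End SingularSystem.

(** * Existence of the canonical tight frame and its similarity to the given frame *)

Section CanonicalTightFrame.
Local Open Scope sesquilinear_scope.
Context {C : numClosedFieldType} {H : hilbertType C} {n : nat}.
Implicit Types (F W : {linear 'rV[C]_n -> H}).

Lemma singular_system_exists F : exists W U s, singular_system F W U s.
Proof.
(* The Gram matrix, which represents F^* F on row vectors; the singular values are the square roots
   of its eigenvalues. *)
pose B : 'M[C]_n := \matrix_(i, j) hdot (F 'e_i) (F 'e_j).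
pose G : 'End('rV[C]_n) := linfun (mulmxr B).
have GE x : G x = adjoint F (F x).
  rewrite lfunE /=; apply/rowP => j; rewrite !mxE (linear_delta_expansion F x).
  rewrite linear_sumlz; apply: eq_bigr => i _.
  by rewrite linearZl_LR !mxE.
have posG : positive_operator G.
  by move=> x; rewrite GE -dot_conj /= -adjointP conjC_ge0 dnorm_ge0.
have [U [t [unitaryU t_ge0 eigG]]] := positive_operator_eigenbasis posG.
have dotF k l : hdot (F (row k U)) (F (row l U)) = t l * (k == l)%:R.
  rewrite adjointP -GE eigG linearZr_LR /= unitary_dot //.
  by rewrite (CrealP (ger0_real (t_ge0 _))).
pose s k := sqrtC (t k).
have s_ge0 k : 0 <= s k by rewrite sqrtC_ge0.
(* Since the inverse of 0 is 0, this is the pseudo-inverse of |F|. *)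
pose D : 'M[C]_n := U^t* *m diag_mx (\row_k (s k)^-1) *m U.
pose W : {linear 'rV[C]_n -> H} := F \o mulmxr D.
have WF k : W (row k U) = (s k)^-1 *: F (row k U).
  rewrite /W /= -linearZ /= -row_mul /D !mulmxA (unitarymxP unitaryU) mul1mx.
  by rewrite row_mul row_diag_mx -scalemxAl -rowE mxE.
exists W, U, s; split=> // k => [|l].
  rewrite WF scalerA; have [sk|sk] := eqVneq (s k) 0.
    rewrite sk mul0r scale0r; apply/eqP; rewrite -(dnorm_eq0 hdot) dotF.
    by rewrite -[t k]sqrtCK -/(s k) sk expr0n mul0r.
  by rewrite mulfV // scale1r.
rewrite !WF linearZl_LR /= linearZr_LR /= dotF.
rewrite (CrealP (ger0_real _)) ?invr_ge0 // -[t l]sqrtCK -/(s l).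
case: eqP => [->|_]; last by rewrite !mulr0.
have [->|sl] := eqVneq (s l) 0; first by rewrite invr0 mul0r.
by rewrite mulr1 expr2 mulKf // mulVf.
Qed.

(** The bound is the sum of |a_k| |b_k|, by the triangle inequality and Cauchy-Schwarz. *)
Lemma bounded_operator_dot_sum (K L : set H) (a b : 'I_n -> H) :
  hilbert_subspace L -> (forall k, L (b k)) ->
  bounded_operator K L (fun y => \sum_k hdot y (a k) *: b k).
Proof.
move=> hL Lb; split=> [y _|c x y _ _|].
- exact: hilbert_subspace_sum.
- rewrite scaler_sumr -big_split; apply: eq_bigr => k _ /=.
  by rewrite linearDl /= linearZl_LR /= scalerDl scalerA.
- exists (\sum_k `|a k| * `|b k|) => y _.
  apply: (le_trans (ler_norm_sum _ _ _)); rewrite mulr_suml ler_sum // => k _.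
  rewrite normrZ mulrAC ler_wpM2r // mulrC.
  have : `|hdot y (a k)| ^+ 2 <= (`|y| * `|a k|) ^+ 2.
    by rewrite exprMn !hnormE dot_cauchy_schwarz.
  by rewrite ler_pXn2r ?nnegrE ?mulr_ge0.
Qed.

Section Frame.
Variables (K : set H) (F W : {linear 'rV[C]_n -> H}).
Variables (U : 'M[C]_n) (s : 'I_n -> C).
Hypotheses (hK : hilbert_subspace K) (frameF : frame K (fun j => F 'e_j)).
Hypothesis sysF : singular_system F W U s.

Lemma singular_system_range x : K (W x).
Proof.
have [unitaryU _ FW _] := sysF; have [KF _] := frameF.
rewrite (linear_unitary_expansion unitaryU W).
apply: (hilbert_subspace_sum _ hK) => k.
have [sk|sk] := eqVneq (s k) 0.
  by rewrite (singular_system_zero sysF) //; case: hK.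
have -> : W (row k U) = (s k)^-1 *: F (row k U).
  by rewrite FW scalerA mulVf // scale1r.
by apply: hilbert_subspaceZ => //; exact: hilbert_subspace_range.
Qed.

Lemma dot_singular_sum (a : 'I_n -> C) k :
  hdot (\sum_l a l *: W (row l U)) (W (row k U)) *: W (row k U) =
    a k *: W (row k U).
Proof.
have [_ _ _ dotW] := sysF.
have [sk|sk] := eqVneq (s k) 0.
  by rewrite (singular_system_zero sysF sk) !scaler0.
congr (_ *: _); rewrite linear_sumlz (bigD1 k) //= big1 => [|l /negPf lk].
  by rewrite addr0 linearZl_LR /= dotW eqxx sk mulr1.
by rewrite linearZl_LR /= dotW lk mulr0.
Qed.

(** The remainder y = x - W W^* x is orthogonal to every W u_k, hence to every frame vector; the
    lower frame bound then forces y = 0. *)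
Lemma singular_system_reconstruction x : K x -> W (adjoint W x) = x.
Proof.
move=> Kx; have [unitaryU _ FW dotW] := sysF.
pose y := x - W (adjoint W x).
have Ky : K y by apply: hilbert_subspaceB => //; exact: singular_system_range.
have yW k : hdot y (W (row k U)) = 0.
  have [sk|sk] := eqVneq (s k) 0.
    by rewrite (singular_system_zero sysF) // linear0r.
  rewrite linearBl /= (frame_operator_expansion _ _ unitaryU) linear_sumlz.
  rewrite (bigD1 k) //= big1 => [|l /negPf lk]; last first.
    by rewrite linearZl_LR /= dotW lk mulr0.
  by rewrite linearZl_LR /= dotW eqxx sk mulr1 addr0 subrr.
have [_ [c [d [c_gt0 _ /(_ y Ky) /andP[+ _]]]]] := frameF.
rewrite big1 => [|j _]; last first.
  rewrite (linear_unitary_expansion unitaryU F) linear_sumr.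
  rewrite big1 ?normr0 ?expr0n //.
  by move=> k _; rewrite linearZr_LR /= FW linearZr_LR /= yW !mulr0.
rewrite pmulr_rle0 // hnormE => y_le0; have : hdot y y == 0.
  by rewrite eq_le y_le0 dnorm_ge0.
by rewrite dnorm_eq0 subr_eq0 => /eqP.
Qed.

Lemma singular_system_tight_frame :
  normalized_tight_frame K (fun j => W 'e_j).
Proof.
split=> [j|x Kx]; first exact: singular_system_range.
rewrite -dot_adjoint -adjointP singular_system_reconstruction // mul1r.
by rewrite hnormE lexx.
Qed.

Lemma singular_system_similar :
  similar_frames K (fun j => F 'e_j) (fun j => W 'e_j).
Proof.
have [unitaryU _ FW _] := sysF.
(* The operator diagonal in the vectors W u_k. [T s] is W |F| W^*, which carries W x to F x;
   inverting the nonzero s_k inverts it on [K]. *)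
pose T (c : 'I_n -> C) y := \sum_k hdot y (W (row k U)) *: (c k *: W (row k U)).
have KW k : K (W (row k U)) by exact: singular_system_range.
have boundedT c : bounded_operator K K (T c).
  by apply: bounded_operator_dot_sum => // k; exact: hilbert_subspaceZ.
have TT c d y : (forall k, s k != 0 -> c k * d k = 1) -> K y -> T c (T d y) = y.
  move=> cd Ky; rewrite -[RHS](singular_system_reconstruction Ky).
  rewrite (frame_operator_expansion _ _ unitaryU); apply: eq_bigr => k _.
  have [sk|sk] := eqVneq (s k) 0.
    by rewrite (singular_system_zero sysF sk) !scaler0.
  rewrite scalerA mulrC -scalerA /T; under eq_bigr do rewrite scalerA.
  rewrite dot_singular_sum scalerA mulrCA mulrC.
  by rewrite cd // mul1r.
have TW x : T s (W x) = F x.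
  rewrite (linear_unitary_expansion unitaryU F); apply: eq_bigr => k _.
  rewrite scalerA mulrC -scalerA (linear_unitary_expansion unitaryU W).
  by rewrite dot_singular_sum scalerA mulrC -scalerA -FW.
exists (T (fun k => (s k)^-1)); split; last first.
  move=> j; rewrite -TW TT // => [k sk|]; first by rewrite mulVf.
  exact: singular_system_range.
split=> //; exists (T s); split=> // y Ky; apply: TT => // k sk.
  by rewrite mulfV.
by rewrite mulVf.
Qed.

End Frame.
End CanonicalTightFrame.

(** * The inequality, its equality case and the symmetric approximation *)

Theorem theorem1p3 (R : realType) (H : hilbertType R[i]) (n : nat)
    (K : set H) (f : 'I_n -> H) (hK : hilbert_subspace K) (hf : frame K f) :
  (forall (L : set H) (mu : 'I_n -> H)
      (F W : {linear 'rV[R[i]]_n -> H}) (absF : 'End('rV[R[i]]_n)),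
    hilbert_subspace L -> normalized_tight_frame L mu ->
    weakly_similar_frames L mu K f ->
    (forall i, F 'e_i = f i) -> polar_decomposition F W absF ->
    let N := \dim (lker absF) in
    let We := fun j : 'I_n => W 'e_j in
    [/\ sqdist mu f >= sqdist We f,
        sqdist We f = hs_norm (\1%VF - absF) ^+ 2 - N%:R
      & sqdist mu f = sqdist We f <-> forall j, mu j = We j]) /\
  (finite_dimensional K ->
    exists nu : 'I_n -> H, symmetric_approximation K f K nu /\
      forall (L : set H) (nu' : 'I_n -> H),
        symmetric_approximation K f L nu' ->
        [/\ nu' = nu, L = K, linear_span nu' = K,
            normalized_tight_frame K nu' & similar_frames K f nu']).
Proof.
split.
  move=> L mu F W A hL tightmu simmu Ff polar.
  have [U [s [sysF eigA]]] := polar_decomposition_singular_system polar.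
  have ef : f = (fun i => F 'e_i) by apply/funext => i.
  have [M Mmu] := linear_extension mu.
  have emu : mu = (fun i => M 'e_i) by apply/funext => i.
  subst f mu; have [KF _] := hf.
  have dotM := tight_frame_singular_norm hL hK tightmu KF simmu sysF.
  move=> N We; split; first exact: (le_sqdist_singular_system sysF dotM).
    exact: (sqdist_hs_norm sysF eigA).
  split=> [eqd j|MW]; first exact: (eq_sqdist_singular_system sysF _ dotM eqd).
  by apply: eq_bigr => j _; rewrite MW.
have [F Ff] := linear_extension f.
have ef : f = (fun i => F 'e_i) by apply/funext => i.
subst f; have [KF _] := hf => finK.
have [W [U [s sysF]]] := singular_system_exists F.
have tightW := singular_system_tight_frame hK hf sysF.
have simW := singular_system_similar hK hf sysF.
exists (fun j => W 'e_j); split.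
  split=> // M mu hM tightmu simmu.
  have [G Gmu] := linear_extension mu.
  have emu : mu = (fun i => G 'e_i) by apply/funext => i.
  subst mu; apply: (le_sqdist_singular_system sysF).
  exact: (tight_frame_singular_norm hM hK tightmu KF simmu sysF).
move=> L nu [hL _ tightnu simnu minnu].
have [G Gnu] := linear_extension nu.
have enu : nu = (fun i => G 'e_i) by apply/funext => i.
subst nu.
have dotG := tight_frame_singular_norm hL hK tightnu KF
  (weakly_similar_frames_sym KF simnu) sysF.
have GW : (fun i => G 'e_i) = (fun i => W 'e_i).
  apply/funext => j; apply: (eq_sqdist_singular_system sysF _ dotG).
  (* The family W e_j is itself an admissible competitor, so minimality of [nu] gives the reverse
     inequality. *)
  apply/le_anti; rewrite (le_sqdist_singular_system sysF dotG) andbT.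
  exact: (minnu _ _ hK tightW (weakly_similar_frames_sym KF simW)).
(* A normalized tight frame spans its subspace, and [L] and [K] now carry the same one. *)
have LK : L = K.
  rewrite -(normalized_tight_frame_span hL tightnu) GW.
  exact: (normalized_tight_frame_span hK tightW).
by rewrite GW; split=> //; exact: (normalized_tight_frame_span hK tightW).
Qed.
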